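(* Let $U$ be a PBW deformation of $S_{\mathbf q}(V)\rtimes G$ in which the action of $G$ on $V$ is preserved. Then there exists a bilinear map $\kappa: V\times V\to (\Bbbk\oplus V)\otimes \Bbbk G$ with $\kappa(v_i,v_j)=-q_{ij}\kappa(v_j,v_i)$ for all $1\le i,j\le n$ such that $\mathcal{H}_{\mathbf q,\kappa}$ is a quantum Drinfeld orbifold algebra and $U\cong \mathcal{H}_{\mathbf q,\kappa}$ as algebras.
   Context: Throughout, $\Bbbk$ is a field of characteristic $0$, tensor products are over $\Bbbk$, $V$ is a finite-dimensional $\Bbbk$-vector space with basis $v_1,\ldots,v_n$, and $\mathbf q=(q_{ij})_{1\le i,j\le n}$ is a tuple of nonzero scalars in $\Bbbk$ with $q_{ii}=1$ and $q_{ji}=q_{ij}^{-1}$ for all $i,j$. The quantum symmetric algebra is $$S_{\mathbf q}(V)=\Bbbk\langle v_1,\ldots,v_n\mid v_iv_j=q_{ij}v_jv_i \text{ for all } 1\le i,j\le n\rangle .$$ $G$ is a finite group acting linearly on $V$ in such a way that there is an induced action on $S_{\mathbf q}(V)$ by algebra automorphisms; the action is written ${}^g v$. For an algebra $S$ with an action of $G$ by automorphisms, the skew group algebra $S\rtimes G$ is $S\otimes \Bbbk G$ as a vector space, with $s\otimes g$ written $s\# g$ and multiplication $(r\# g)(s\# h)=r({}^g s)\# gh$. The algebras $S_{\mathbf q}(V)\rtimes G$ and $T(V)\rtimes G$ ($T(V)$ the tensor algebra) are graded with elements of $V$ in degree $1$ and elements of $G$ in degree $0$. For a bilinear map $\kappa: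 V\times V\to(\Bbbk\oplus V)\otimes \Bbbk G$ with $\kappa(v_i,v_j)=-q_{ij}\kappa(v_j,v_i)$ for all $i,j$, identify the target with the subspace of elements of degree at most $1$ in $T(V)\rtimes G$ and put $$\mathcal{H}_{\mathbf q,\kappa}=(T(V)\rtimes G)\big/\big(v_iv_j-q_{ij}v_jv_i-\kappa(v_i,v_j)\mid 1\le i,j\le n\big).$$ This is a filtered algebra. It is called a quantum Drinfeld orbifold algebra if its associated graded algebra is isomorphic to $S_{\mathbf q}(V)\rtimes G$; equivalently, if $\{v_1^{m_1}\cdots v_n^{m_n}\# g\mid m_i\ge 0,\ g\in G\}$ is a $\Bbbk$-basis of $\mathcal{H}_{\mathbf q,\kappa}$. A PBW deformation of $S_{\mathbf q}(V)\rtimes G$ is an associative unital $\Bbbk$-algebra $U$ with an increasing exhaustive filtration $F_0U\subseteq F_1U\subseteq\cdots$ (with $F_mU=0$ for $m<0$) whose associated graded algebra $\operatorname{gr}U$ is isomorphic, as a graded algebra, to $S_{\mathbf q}(V)\rtimes G$. Thus $F_0U$ is identified with $\Bbbk G$, and $F_1U$ may be identified with $(V\otimes\Bbbk G)\oplus\Bbbk G$ compatibly with the identification of $F_1U/F_0U$ with $V\otimes \Bbbk G$. The action of $G$ on $V$ is said to be preserved in $U$ if, for a suitable such identification (so that $V$ and $G$ are regarded as subsets of $F_1U$, with the image of $v\# g$ equal to the product $vg$ in $U$), the relations $gv={}^g v\, g$ hold in $U$ for all $g\in G$, $v\in V$. *)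

(* Defs.v *)
From HB Require Import structures.
From mathcomp Require Import all_boot all_order all_fingroup all_algebra.
From mathcomp Require Import ring_quotient.
From mathcomp Require Import boolp.
From mathcomp Require Import finmap monalg.

Set Implicit Arguments.
Unset Strict Implicit.
Unset Printing Implicit Defensive.

Import GRing.Theory.
Local Open Scope ring_scope.
Local Obligation Tactic := idtac.

Section Ideal.
Variables (k : fieldType) (A : algType k).

Record ideal := Ideal {
  ideal_set :> A -> Prop;
  ideal_0 : ideal_set 0;
  ideal_D : forall x y, ideal_set x -> ideal_set y -> ideal_set (x + y);
  ideal_Ml : forall a x, ideal_set x -> ideal_set (a * x);
  ideal_Mr : forall a x, ideal_set x -> ideal_set (x * a)
}.

Program Definition ideal_gen (X : A -> Prop) : ideal :=
  @Ideal (fun x => forall I : ideal, (forall y, X y -> I y) -> I x) _ _ _ _.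
Next Obligation. by move=> X I _; apply: ideal_0. Qed.
Next Obligation.
by move=> X x y Ix Iy I XI; apply: ideal_D; [apply: Ix | apply: Iy].
Qed.
Next Obligation. by move=> X a x Ix I XI; apply/ideal_Ml/Ix. Qed.
Next Obligation. by move=> X a x Ix I XI; apply/ideal_Mr/Ix. Qed.

(* [algType k] excludes the zero ring, so the quotient by an ideal is only
   formed when the ideal is proper. *)
Definition is_proper (I : ideal) : Prop := ~ I 1.

Definition ideal_mem (I : ideal) : {pred A} := fun x => `[< I x >].

Lemma ideal_memP (I : ideal) x : reflect (I x) (x \in ideal_mem I).
Proof. exact: asboolP. Qed.

Fact ideal_mem_closed I : zmod_closed (ideal_mem I).
Proof.
split=> [|x y /ideal_memP Ix /ideal_memP Iy]; apply/ideal_memP.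
  exact: ideal_0.
by apply: ideal_D => //; rewrite -mulN1r; apply: ideal_Ml.
Qed.
HB.instance Definition _ I :=
  GRing.isZmodClosed.Build A (ideal_mem I) (ideal_mem_closed I).

Lemma ideal_Z (I : ideal) (a : k) x : I x -> I (a *: x).
Proof. by move=> Ix; rewrite -[x]mul1r scalerAl; apply: ideal_Ml. Qed.

Definition quot_alg (I : ideal) of is_proper I := Quotient.quot (ideal_mem I).

End Ideal.

Section Quotient.
Variables (k : fieldType) (A : algType k) (I : ideal A) (hI : is_proper I).
Local Notation Q := (quot_alg hI).

HB.instance Definition _ := GRing.Zmodule.on Q.

Definition qpi (x : A) : Q := \pi_(Quotient.quot (ideal_mem I))%qT x.

Lemma qpiP x y : qpi x = qpi y <-> I (x - y).
Proof.
split=> [/eqP|Ixy].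
  by rewrite /qpi -Quotient.idealrBE => /ideal_memP.
by apply/eqP; rewrite /qpi -Quotient.idealrBE; apply/ideal_memP.
Qed.

Lemma qpi_surj (u : Q) : exists x, u = qpi x.
Proof. by exists (generic_quotient.repr u); rewrite /qpi reprK. Qed.

Fact qpi_add : {morph qpi : x y / x + y}.
Proof. by move=> x y; rewrite /qpi Quotient.pi_add. Qed.

Let rp (u : Q) : A := generic_quotient.repr u.
Let rpP u : qpi (rp u) = u. Proof. by rewrite /qpi reprK. Qed.

Definition quot_one : Q := qpi 1.
Definition quot_mul (u v : Q) : Q := qpi (rp u * rp v).
Definition quot_scale (a : k) (u : Q) : Q := qpi (a *: rp u).

Fact qpi_mul x y : quot_mul (qpi x) (qpi y) = qpi (x * y).
Proof.
apply/qpiP; set x' := rp _; set y' := rp _.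
have -> : x' * y' - x * y = (x' - x) * y' + x * (y' - y).
  by rewrite mulrBl mulrBr addrA subrK.
by apply: ideal_D; [apply: ideal_Mr | apply: ideal_Ml]; apply/qpiP; rewrite rpP.
Qed.

Fact qpi_scale a x : quot_scale a (qpi x) = qpi (a *: x).
Proof. by apply/qpiP; rewrite -scalerBr; apply/ideal_Z/qpiP; rewrite rpP. Qed.

Fact qpi_ind (P : Q -> Prop) : (forall x, P (qpi x)) -> forall u, P u.
Proof. by move=> H u; have [x ->] := qpi_surj u. Qed.

Fact quot_mulA : associative quot_mul.
Proof.
by elim/qpi_ind=> x; elim/qpi_ind=> y; elim/qpi_ind=> z; rewrite !qpi_mul mulrA.
Qed.
Fact quot_1mul : left_id quot_one quot_mul.
Proof. by elim/qpi_ind=> x; rewrite qpi_mul mul1r. Qed.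
Fact quot_mul1 : right_id quot_one quot_mul.
Proof. by elim/qpi_ind=> x; rewrite qpi_mul mulr1. Qed.
Fact quot_mulDl : left_distributive quot_mul +%R.
Proof.
elim/qpi_ind=> x; elim/qpi_ind=> y; elim/qpi_ind=> z.
by rewrite -qpi_add !qpi_mul mulrDl qpi_add.
Qed.
Fact quot_mulDr : right_distributive quot_mul +%R.
Proof.
elim/qpi_ind=> x; elim/qpi_ind=> y; elim/qpi_ind=> z.
by rewrite -qpi_add !qpi_mul mulrDr qpi_add.
Qed.
Fact quot_1neq0 : quot_one != 0.
Proof.
apply/eqP=> /= h; apply: hI; rewrite -[1]subr0; apply/qpiP.
have -> : qpi 0 = 0 by apply: (addrI (qpi 0)); rewrite -qpi_add !addr0.
exact: h.
Qed.
HB.instance Definition _ := GRing.Zmodule_isNzRing.Build Q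
  quot_mulA quot_1mul quot_mul1 quot_mulDl quot_mulDr quot_1neq0.

Fact quot_scaleA a b v : quot_scale a (quot_scale b v) = quot_scale (a * b) v.
Proof. by elim/qpi_ind: v => x; rewrite !qpi_scale scalerA. Qed.
Fact quot_scale1 : left_id 1 quot_scale.
Proof. by elim/qpi_ind=> x; rewrite qpi_scale scale1r. Qed.
Fact quot_scaleDr : right_distributive quot_scale +%R.
Proof.
move=> a; elim/qpi_ind=> x; elim/qpi_ind=> y.
by rewrite -qpi_add !qpi_scale scalerDr qpi_add.
Qed.
Fact quot_scaleDl v : {morph quot_scale^~ v : a b / a + b}.
Proof. by elim/qpi_ind: v => x a b; rewrite !qpi_scale scalerDl qpi_add. Qed.
HB.instance Definition _ := GRing.Zmodule_isLmodule.Build k Q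
  quot_scaleA quot_scale1 quot_scaleDr quot_scaleDl.

Fact qpi_monoid : monoid_morphism qpi.
Proof. by split=> // x y; rewrite -qpi_mul. Qed.
Fact qpi_linear : linear qpi.
Proof. by move=> a x y; rewrite qpi_add -qpi_scale. Qed.
HB.instance Definition _ := GRing.isLinear.Build k A Q *:%R qpi qpi_linear.
HB.instance Definition _ := GRing.isMonoidMorphism.Build A Q qpi qpi_monoid.

Fact quot_scaleAl a (x y : Q) : a *: (x * y) = a *: x * y.
Proof.
elim/qpi_ind: x => x; elim/qpi_ind: y => y.
by rewrite -rmorphM -!linearZ -rmorphM /= scalerAl.
Qed.
Fact quot_scaleAr a (x y : Q) : a *: (x * y) = x * (a *: y).
Proof.
elim/qpi_ind: x => x; elim/qpi_ind: y => y.
by rewrite -rmorphM -!linearZ -rmorphM /= scalerAr.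
Qed.
HB.instance Definition _ := GRing.Lmodule_isLalgebra.Build k Q quot_scaleAl.
HB.instance Definition _ := GRing.Lalgebra_isAlgebra.Build k Q quot_scaleAr.

End Quotient.

Record lin_action (k : fieldType) (gT : finGroupType) (V : lmodType k) :=
  LinAction {
    lin_act :> gT -> {linear V -> V};
    lin_act1 : forall x, lin_act 1%g x = x;
    lin_actM : forall g h x, lin_act (g * h)%g x = lin_act g (lin_act h x)
  }.

Record alg_action (k : fieldType) (gT : finGroupType) (A : algType k) :=
  AlgAction {
    alg_act :> gT -> {lrmorphism A -> A};
    alg_act1 : forall x, alg_act 1%g x = x;
    alg_actM : forall g h x, alg_act (g * h)%g x = alg_act g (alg_act h x)
  }.

(* W tensor kG is realized as {ffun gT -> W}, with w tensor g the function
   supported at g with value w. *)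
Definition tensG (gT : finGroupType) (W : zmodType) (w : W) (g : gT) :
    {ffun gT -> W} :=
  [ffun x => if x == g then w else 0].

Section Skew.
Variables (k : fieldType) (gT : finGroupType) (A : algType k).
Variable act : alg_action gT A.

Definition skew_group_alg of alg_action gT A := {ffun gT -> A}.
Local Notation S := (skew_group_alg act).
HB.instance Definition _ := GRing.Lmodule.on S.

Definition skew_one : S := tensG 1 1%g.
Definition skew_mul (r s : S) : S :=
  [ffun x => \sum_(g : gT) r g * act g (s (g^-1 * x)%g)].

Lemma skew_mul_tens (r s : A) (g h : gT) :
  skew_mul (tensG r g) (tensG s h) = tensG (r * act g s) (g * h)%g.
Proof.
apply/ffunP=> x; rewrite !ffunE (bigD1 g) //= !ffunE eqxx big1 ?addr0.
  rewrite -(inj_eq (mulgI g)) mulKVg.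
  by case: eqP => // _; rewrite raddf0 mulr0.
by move=> i /negbTE ig; rewrite ffunE ig mul0r.
Qed.

Fact skew_mulA : associative skew_mul.
Proof.
move=> r s t; apply/ffunP=> x; rewrite !ffunE.
under eq_bigr => g _.
  rewrite ffunE raddf_sum mulr_sumr (reindex_inj (mulgI g^-1%g)) /=.
  under eq_bigr => h _ do rewrite rmorphM /= -alg_actM mulKVg mulrA invMg invgK
    -mulgA mulKVg.
  over.
rewrite exchange_big /=; apply: eq_bigr => h _.
by rewrite ffunE mulr_suml.
Qed.
Fact skew_1mul : left_id skew_one skew_mul.
Proof.
move=> s; apply/ffunP=> x; rewrite !ffunE (bigD1 1%g) //= ffunE eqxx big1.
  by rewrite addr0 mul1r alg_act1 invg1 mul1g.
by move=> g /negbTE g1; rewrite ffunE g1 mul0r.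
Qed.
Fact skew_mul1 : right_id skew_one skew_mul.
Proof.
move=> s; apply/ffunP=> x; rewrite !ffunE (bigD1 x) //= ffunE mulVg eqxx big1.
  by rewrite addr0 rmorph1 mulr1.
move=> g gx; rewrite ffunE -(inj_eq (mulgI g)) mulKVg mulg1 eq_sym (negbTE gx).
by rewrite raddf0 mulr0.
Qed.
Fact skew_mulDl : left_distributive skew_mul +%R.
Proof.
move=> r s t; apply/ffunP=> x; rewrite !ffunE -big_split /=.
by apply: eq_bigr => g _; rewrite ffunE mulrDl.
Qed.
Fact skew_mulDr : right_distributive skew_mul +%R.
Proof.
move=> r s t; apply/ffunP=> x; rewrite !ffunE -big_split /=.
by apply: eq_bigr => g _; rewrite ffunE raddfD mulrDr.
Qed.
Fact skew_1neq0 : skew_one != 0.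
Proof.
apply/eqP=> /ffunP/(_ 1%g); rewrite !ffunE eqxx => /eqP.
by rewrite oner_eq0.
Qed.
HB.instance Definition _ := GRing.Zmodule_isNzRing.Build S
  skew_mulA skew_1mul skew_mul1 skew_mulDl skew_mulDr skew_1neq0.

Fact skew_scaleAl a (x y : S) : a *: (x * y) = a *: x * y.
Proof.
apply/ffunP=> z; rewrite !ffunE scaler_sumr.
by apply: eq_bigr => g _; rewrite ffunE scalerAl.
Qed.
Fact skew_scaleAr a (x y : S) : a *: (x * y) = x * (a *: y).
Proof.
apply/ffunP=> z; rewrite !ffunE scaler_sumr.
by apply: eq_bigr => g _; rewrite ffunE linearZ /= scalerAr.
Qed.
HB.instance Definition _ := GRing.Lmodule_isLalgebra.Build k S skew_scaleAl.
HB.instance Definition _ := GRing.Lalgebra_isAlgebra.Build k S skew_scaleAr.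

Definition skewt (a : A) (g : gT) : S := tensG a g.

End Skew.

Section Filtration.
Variables (k : fieldType) (A : algType k).

Record filtration := Filtration {
  fil :> nat -> A -> Prop;
  fil_linear : forall m (a : k) x y, fil m x -> fil m y -> fil m (a *: x + y);
  fil_incr : forall m x, fil m x -> fil m.+1 x;
  fil_exhaustive : forall x, exists m, fil m x;
  fil_1 : fil 0 1;
  fil_M : forall i j x y, fil i x -> fil j y -> fil (i + j) (x * y)
}.

Variable F : filtration.

(* F_(m-1), with F_(-1) = 0. *)
Definition fil_pred (m : nat) (x : A) : Prop :=
  if m is m'.+1 then F m' x else x = 0.

Lemma fil_le i j x : (i <= j)%N -> F i x -> F j x.
Proof.
move=> /subnK <- Fx; elim: (j - i)%N => // d IH.
by rewrite addSn; apply: fil_incr.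
Qed.

Lemma fil0 m : F m 0.
Proof.
have F1 : F m 1 by apply: (@fil_le 0) => //; apply: fil_1.
by rewrite -[0](addNr 1) -scaleN1r; apply: fil_linear.
Qed.

Lemma filZ m (a : k) x : F m x -> F m (a *: x).
Proof. by move=> Fx; rewrite -[_ *: _]addr0; apply/fil_linear/fil0. Qed.

Lemma filD m x y : F m x -> F m y -> F m (x + y).
Proof. by move=> Fx Fy; rewrite -[x]scale1r; apply: fil_linear. Qed.

Lemma filB m x y : F m x -> F m y -> F m (x - y).
Proof. by move=> Fx Fy; rewrite addrC -scaleN1r; apply: fil_linear. Qed.

Lemma fil_sum m (T : Type) (r : seq T) (P : pred T) (f : T -> A) :
  (forall i, P i -> F m (f i)) -> F m (\sum_(i <- r | P i) f i).
Proof. by move=> H; apply: big_ind => //; [apply: fil0 | apply: filD]. Qed.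

(* The direct sum of the F_m is realized as the subring of the polynomials over
   A whose m-th coefficient lies in F_m. *)
Definition rees_mem : {pred {poly A}} := fun p : {poly A} => `[< forall m, F m p`_m >].

Lemma rees_memP (p : {poly A}) : reflect (forall m, F m p`_m) (p \in rees_mem).
Proof. exact: asboolP. Qed.

Fact rees_subring : subring_closed rees_mem.
Proof.
split=> [|p q /rees_memP Fp /rees_memP Fq|p q /rees_memP Fp /rees_memP Fq];
  apply/rees_memP=> m.
- by rewrite coef1; case: m => [|m]; [apply: fil_1 | apply: fil0].
- by rewrite coefB; apply: filB.
- rewrite coefM; apply: fil_sum => i _.
  by have := fil_M (Fp i) (Fq (m - i)%N); rewrite subnKC // -ltnS.
Qed.
HB.instance Definition _ := GRing.isSubringClosed.Build {poly A} rees_mem rees_subring.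

Record rees := Rees { rees_poly :> {poly A}; _ : rees_poly \in rees_mem }.
HB.instance Definition _ := [isSub for rees_poly].
HB.instance Definition _ := [Choice of rees by <:].
HB.instance Definition _ := [SubChoice_isSubNzRing of rees by <:].

Lemma rees_coef (p : rees) m : F m (p : {poly A})`_m.
Proof. by case: p => p /= /rees_memP. Qed.

Fact rees_scale_mem (a : k) (p : rees) : a%:A *: (p : {poly A}) \in rees_mem.
Proof.
apply/rees_memP => m; rewrite coefZ -scalerAl mul1r; apply: filZ.
exact: rees_coef.
Qed.
Definition rees_scale a p : rees := Rees (rees_scale_mem a p).

Fact rees_scaleA a b v : rees_scale a (rees_scale b v) = rees_scale (a * b) v.
Proof. by apply/val_inj; rewrite /= scalerA -scalerAl mul1r scalerA. Qed.
Fact rees_scale1 : left_id 1 rees_scale.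
Proof. by move=> v; apply/val_inj; rewrite /= !scale1r. Qed.
Fact rees_scaleDr : right_distributive rees_scale +%R.
Proof. by move=> a u v; apply/val_inj; rewrite /= scalerDr. Qed.
Fact rees_scaleDl v : {morph rees_scale^~ v : a b / a + b}.
Proof. by move=> a b; apply/val_inj; rewrite /= !scalerDl. Qed.
HB.instance Definition _ := GRing.Zmodule_isLmodule.Build k rees
  rees_scaleA rees_scale1 rees_scaleDr rees_scaleDl.
Fact rees_scaleAl a (x y : rees) : a *: (x * y) = a *: x * y.
Proof. by apply/val_inj; rewrite /= scalerAl. Qed.
Fact rees_scaleAr a (x y : rees) : a *: (x * y) = x * (a *: y).
Proof.
apply/val_inj; rewrite /=; apply/polyP=> m; rewrite coefZ !coefM mulr_sumr.
apply: eq_bigr => i _; rewrite coefZ !mulrA; congr (_ * _).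
by rewrite mulr_algl mulr_algr.
Qed.
HB.instance Definition _ := GRing.Lmodule_isLalgebra.Build k rees rees_scaleAl.
HB.instance Definition _ := GRing.Lalgebra_isAlgebra.Build k rees rees_scaleAr.

Lemma fil_predD m x y : fil_pred m x -> fil_pred m y -> fil_pred m (x + y).
Proof. by case: m => [->->|m] /=; rewrite ?addr0 //; apply: filD. Qed.

Lemma fil_pred_Ml i j x y : F i x -> fil_pred j y -> fil_pred (i + j) (x * y).
Proof.
case: j => [|j] Fx /= Fy; last by rewrite addnS; apply: fil_M.
by rewrite Fy mulr0 addn0; case: i Fx => //= i _; apply: fil0.
Qed.

Lemma fil_pred_Mr i j x y : fil_pred i x -> F j y -> fil_pred (i + j) (x * y).
Proof.
case: i => [|i] /= Fx Fy; last by apply: fil_M.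
by rewrite Fx mul0r add0n; case: j Fy => //= j _; apply: fil0.
Qed.

Lemma fil_pred0 m : fil_pred m 0.
Proof. by case: m => //= m; apply: fil0. Qed.

Lemma fil_pred_sum m (T : Type) (r : seq T) (P : pred T) (f : T -> A) :
  (forall i, P i -> fil_pred m (f i)) -> fil_pred m (\sum_(i <- r | P i) f i).
Proof. by move=> H; apply: big_ind => //; [apply: fil_pred0 | apply: fil_predD]. Qed.

(* The direct sum of the F_(m-1) inside that of the F_m. *)
Program Definition gr_ideal : ideal rees :=
  @Ideal k rees (fun p => forall m, fil_pred m (p : {poly A})`_m) _ _ _ _.
Next Obligation. by move=> m; rewrite /= coef0; apply: fil_pred0. Qed.
Next Obligation. by move=> p q Ip Iq m; rewrite /= coefD; apply: fil_predD. Qed.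
Next Obligation.
move=> p q Iq m; have Fp := rees_coef p; rewrite /= coefM; apply: fil_pred_sum => i _.
by have := fil_pred_Ml (Fp i) (Iq (m - i)%N); rewrite subnKC // -ltnS.
Qed.
Next Obligation.
move=> p q Iq m; have Fp := rees_coef p; rewrite /= coefMr; apply: fil_pred_sum => i _.
by have := fil_pred_Mr (Iq (m - i)%N) (Fp i); rewrite subnK // -ltnS.
Qed.

Fact gr_ideal_proper : is_proper gr_ideal.
Proof. by move=> /(_ 0) /= /eqP; rewrite coef1 oner_eq0. Qed.

Definition assoc_gr : algType k := quot_alg gr_ideal_proper.

Fact gr_class_mem m x : F m x -> x *: 'X^m \in rees_mem.
Proof.
move=> Fx; apply/rees_memP=> i; rewrite coefZ coefXn.
by case: eqP => [->|_]; rewrite ?mulr1 ?mulr0 //; apply: fil0.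
Qed.

Definition gr_class m x (Fx : F m x) : assoc_gr := qpi _ (Rees (gr_class_mem Fx)).

Definition gr_comp (m : nat) (u : assoc_gr) : Prop :=
  exists x (Fx : F m x), u = gr_class Fx.

End Filtration.

Definition graded_iso (k : fieldType) (A B : algType k)
    (Acomp : nat -> A -> Prop) (Bcomp : nat -> B -> Prop)
    (f : {lrmorphism A -> B}) : Prop :=
  bijective f /\ forall m x, Acomp m x <-> Bcomp m (f x).

(* T(V) for V with a basis indexed by 'I_n: the free algebra k<v_1, ..., v_n>. *)
Definition free_alg (k : fieldType) (n : nat) := {malg k[{fmonom 'I_n}]}.

Section FreeAlg.
Variables (k : fieldType) (n : nat).
Local Notation T := (free_alg k n).
HB.instance Definition _ := GRing.Lalgebra.on T.

Fact free_scaleAr a (x y : T) : a *: (x * y) = x * (a *: y).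
Proof.
have xa : x * malgC a = a *: x.
  rewrite [LHS]fgmulgU [RHS]malgZ_def; apply: eq_bigr => w _.
  by rewrite mulm1 mulrC.
by rewrite -[a *: y]mul_malgC mulrA xa scalerAl.
Qed.
HB.instance Definition _ := GRing.Lalgebra_isAlgebra.Build k T free_scaleAr.

Definition free_gen (i : 'I_n) : T := << fmu i >>.

Lemma free_word (w : {fmonom 'I_n}) : (<< w >> : T) = \prod_(i <- w) free_gen i.
Proof.
case: w => s; elim: s => [|i s IH].
  by rewrite big_nil; congr mkmalgU; rewrite -fmoneE.
rewrite big_cons -[X in _ * X]IH [RHS]fgmulUU mulr1; congr mkmalgU.
by apply/eqP; rewrite fmP fmM fmU.
Qed.

Lemma free_expand (t : T) : t = \sum_(w <- msupp t) t@_w *: (<< w >> : T).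
Proof.
rewrite [LHS]monalgE; apply: eq_bigr => w _.
by apply/malgP=> w'; rewrite mcoeffZ !mcoeffU mulrnAr mulr1.
Qed.

Definition free_deg_le (m : nat) (t : T) : Prop :=
  forall w, w \in msupp t -> (fdeg w <= m)%N.

Definition free_homog (m : nat) (t : T) : Prop :=
  forall w, w \in msupp t -> fdeg w = m.

Lemma free_deg_le0 m : free_deg_le m 0.
Proof. by move=> w; rewrite msupp0 in_fset0. Qed.

Lemma free_deg_leD m t u :
  free_deg_le m t -> free_deg_le m u -> free_deg_le m (t + u).
Proof.
move=> mt mu w /(fsubsetP (msuppD_le _ _)).
by rewrite in_fsetU => /orP[/mt|/mu].
Qed.

Lemma free_deg_leZ m a t : free_deg_le m t -> free_deg_le m (a *: t).
Proof. by move=> mt w /(fsubsetP (msuppZ_le _ _)) /mt. Qed.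

Lemma free_deg_leM i j t u :
  free_deg_le i t -> free_deg_le j u -> free_deg_le (i + j) (t * u).
Proof.
move=> it ju w /msuppM_le[w1 [w2 [/it h1 /ju h2 ->]]].
by rewrite fdegM leq_add.
Qed.

Lemma free_deg_le1 : free_deg_le 0 1.
Proof. by move=> w; rewrite msuppU1 in_fset1 => /eqP->; rewrite fdeg1. Qed.

Lemma free_deg_le_gen i : free_deg_le 1 (free_gen i).
Proof. by move=> w; rewrite msuppU1 in_fset1 => /eqP->; rewrite fdegU. Qed.

Lemma free_deg_le_sum m (J : Type) (r : seq J) (P : pred J) (f : J -> T) :
  (forall i, P i -> free_deg_le m (f i)) ->
  free_deg_le m (\sum_(i <- r | P i) f i).
Proof.
by move=> H; apply: big_ind => //; [apply: free_deg_le0 | apply: free_deg_leD].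
Qed.

Lemma free_deg_le_trans i j t : (i <= j)%N -> free_deg_le i t -> free_deg_le j t.
Proof. by move=> ij it w /it h; apply: leq_trans ij. Qed.

Variables (B : algType k).

Definition word_ext (f : 'I_n -> B) (w : {fmonom 'I_n}) : B :=
  \prod_(i <- w) f i.

(* The algebra morphism sending v_i to f i. *)
Definition free_ext (f : 'I_n -> B) : T -> B := mmap (in_alg B) (word_ext f).

Section Ext.
Variable f : 'I_n -> B.

Fact word_ext_mmorphism : mmorphism (word_ext f).
Proof. by rewrite /word_ext; split=> [x y|]; rewrite ?fmM ?big_cat // fm1 big_nil. Qed.
HB.instance Definition _ :=
  isMultiplicative.Build _ _ (word_ext f) word_ext_mmorphism.

Fact free_ext_linear : linear (free_ext f).
Proof.
by move=> a x y; rewrite /free_ext raddfD /= mmapZ /= mulr_algl.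
Qed.
Fact free_ext_monoid : monoid_morphism (free_ext f).
Proof.
have H := @commr_mmap_is_multiplicative _ _ _ (in_alg B) (word_ext f).
have [|HM H1] := H; last by split.
by move=> g m m'; rewrite /GRing.comm /= mulr_algl mulr_algr.
Qed.
HB.instance Definition _ :=
  GRing.isLinear.Build k T B *:%R (free_ext f) free_ext_linear.
HB.instance Definition _ :=
  GRing.isMonoidMorphism.Build T B (free_ext f) free_ext_monoid.

Lemma free_ext_gen i : free_ext f (free_gen i) = f i.
Proof. by rewrite /free_ext mmapU /word_ext fmU big_seq1 /= scale1r mul1r. Qed.
End Ext.

Lemma free_lrmorph_eq (f g : {lrmorphism T -> B}) :
  (forall i, f (free_gen i) = g (free_gen i)) -> f =1 g.
Proof.
move=> fg t; rewrite [t]free_expand !raddf_sum; apply: eq_bigr => w _ /=.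
rewrite !linearZ /= free_word !rmorph_prod; congr (_ *: _).
by apply: eq_bigr => i _; apply: fg.
Qed.

End FreeAlg.

Section TensorAction.
Variables (k : fieldType) (n : nat) (V : vectType k) (b : n.-tuple V).
Variable (gT : finGroupType).
Local Notation T := (free_alg k n).

(* The inclusion of V in T(V) in degree 1, when b is a basis of V. *)
Definition free_inj (x : V) : T := \sum_(i < n) coord b i x *: free_gen k i.

Fact free_inj_linear : linear free_inj.
Proof.
move=> a x y; rewrite scaler_sumr -big_split; apply: eq_bigr => i _.
by rewrite linearP scalerDl scalerA.
Qed.
HB.instance Definition _ :=
  GRing.isLinear.Build k V T *:%R free_inj free_inj_linear.

Variable act : lin_action gT V.
Hypothesis hb : basis_of fullv b.

Definition tensor_act_fun (g : gT) : {lrmorphism T -> T} :=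
  free_ext (fun i => free_inj (act g (tnth b i))).

Lemma tensor_act_inj g x : tensor_act_fun g (free_inj x) = free_inj (act g x).
Proof.
rewrite [in RHS](coord_basis hb (memvf x)) !raddf_sum; apply: eq_bigr => i _ /=.
by rewrite !linearZ /= free_ext_gen (tnth_nth 0).
Qed.

Lemma free_inj_basis i : free_inj (tnth b i) = free_gen k i.
Proof.
rewrite /free_inj (bigD1 i) //= (tnth_nth 0) !coord_free ?(basis_free hb) //.
rewrite eqxx scale1r big1 ?addr0 // => j ji.
by rewrite coord_free ?(basis_free hb) // eq_sym (negbTE ji) scale0r.
Qed.

Fact tensor_act1 x : tensor_act_fun 1%g x = x.
Proof.
apply: (@free_lrmorph_eq _ _ _ _ idfun) => i.
by rewrite -free_inj_basis tensor_act_inj lin_act1.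
Qed.
Fact tensor_actM g h x :
  tensor_act_fun (g * h)%g x = tensor_act_fun g (tensor_act_fun h x).
Proof.
apply: (@free_lrmorph_eq _ _ _ _ (tensor_act_fun g \o tensor_act_fun h)) => i /=.
by rewrite -free_inj_basis !tensor_act_inj lin_actM.
Qed.

Definition tensor_act : alg_action gT T := AlgAction tensor_act1 tensor_actM.

Lemma free_deg_le_inj x : free_deg_le 1 (free_inj x).
Proof.
by apply: free_deg_le_sum => i _; apply/free_deg_leZ/free_deg_le_gen.
Qed.

Lemma free_deg_le_act g m t : free_deg_le m t -> free_deg_le m (tensor_act g t).
Proof.
move=> mt; rewrite [t]free_expand raddf_sum big_seq.
apply: free_deg_le_sum => w /mt wm.
rewrite [X in free_deg_le _ X]linearZ /= free_word rmorph_prod.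
apply: free_deg_leZ; apply: free_deg_le_trans wm _; rewrite /fdeg.
elim: (w : seq _) => [|i s IH]; first by rewrite big_nil; apply: free_deg_le1.
rewrite big_cons -[size _]/(1 + size s)%N; apply: free_deg_leM => //.
by rewrite [X in free_deg_le _ X]free_ext_gen; apply: free_deg_le_inj.
Qed.

End TensorAction.

Section QuantumSymmetric.
Variables (k : fieldType) (n : nat) (q : 'I_n -> 'I_n -> k).
Local Notation T := (free_alg k n).
Local Notation v := (free_gen k).

Definition qsym_rel (t : T) : Prop :=
  exists i j, t = v i * v j - q i j *: (v j * v i).

Fact qsym_proper : is_proper (ideal_gen qsym_rel).
Proof.
pose o : {fmonom 'I_n} := mone.
pose P (t : T) : Prop := t@_o = 0.
have PD x y : P x -> P y -> P (x + y).
  by rewrite /P mcoeffD => -> ->; rewrite addr0.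
have PM x y : (x * y : T)@_o = x@_o * y@_o by rewrite rmorphM.
have PMl a x : P x -> P (a * x) by rewrite /P PM => ->; rewrite mulr0.
have PMr a x : P x -> P (x * a) by rewrite /P PM => ->; rewrite mul0r.
move=> /(_ (@Ideal _ _ P (mcoeff0 _) PD PMl PMr)) /= H.
have /eqP : P 1.
  apply: H => _ [i [j ->]].
  have P1 l : (v l : T)@_o = 0 by rewrite mcoeffU fm1_eq1.
  by rewrite /P mcoeffB mcoeffZ !PM !P1 !mulr0 subr0.
by rewrite mcoeff1 eqxx oner_eq0.
Qed.

Definition qsym : algType k := quot_alg qsym_proper.

Definition qsym_pi : {lrmorphism T -> qsym} := qpi qsym_proper.

End QuantumSymmetric.

Section Main.
Variables (k : fieldType) (n : nat) (V : vectType k) (b : n.-tuple V).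
Hypothesis hb : basis_of fullv b.
Variables (gT : finGroupType) (act : lin_action gT V).
Variable q : 'I_n -> 'I_n -> k.

Definition induced_action (actS : alg_action gT (qsym q)) : Prop :=
  forall g x, actS g (qsym_pi q (free_inj b x)) = qsym_pi q (free_inj b (act g x)).

Definition qsymG_comp (actS : alg_action gT (qsym q)) (m : nat)
    (y : skew_group_alg actS) : Prop :=
  forall g, exists2 t, free_homog m t & y g = qsym_pi q t.

(* (k + V) tensor kG; [kVG_incl] identifies it with the elements of degree at
   most 1 of the skew group algebra of T(V). *)
Definition kVG := {ffun gT -> (k^o * V)%type}.
HB.instance Definition _ := GRing.Lmodule.on kVG.

Definition kVG_group (g : gT) : kVG := tensG (1, 0) g.
Definition kVG_vect (x : V) (g : gT) : kVG := tensG (0, x) g.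

Local Notation TG := (skew_group_alg (tensor_act act hb)).

Definition kVG_incl (w : kVG) : TG :=
  [ffun g => (w g).1%:A + free_inj b (w g).2].

Section Drinfeld.
Variable kappa : V -> V -> kVG.
Let v (i : 'I_n) : TG := skewt _ (free_inj b (tnth b i)) 1%g.

Definition drinfeld_rel (y : TG) : Prop :=
  exists i j, y = v i * v j - q i j *: (v j * v i)
                  - kVG_incl (kappa (tnth b i) (tnth b j)).

Definition drinfeld_ideal : ideal TG := ideal_gen drinfeld_rel.

Hypothesis hp : is_proper drinfeld_ideal.

Definition drinfeld : algType k := quot_alg hp.

Definition drinfeld_pi : {lrmorphism TG -> drinfeld} := qpi hp.

Definition skew_deg_le (m : nat) (y : TG) : Prop :=
  forall g, free_deg_le m (y g).

Definition drinfeld_fil_set (m : nat) (x : drinfeld) : Prop :=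
  exists2 y, skew_deg_le m y & x = drinfeld_pi y.

Fact drinfeld_fil_linear m (a : k) x y :
  drinfeld_fil_set m x -> drinfeld_fil_set m y -> drinfeld_fil_set m (a *: x + y).
Proof.
move=> [t mt ->] [u mu ->]; exists (a *: t + u); last by rewrite linearP.
by move=> g; rewrite !ffunE; apply: free_deg_leD => //; apply: free_deg_leZ.
Qed.
Fact drinfeld_fil_incr m x : drinfeld_fil_set m x -> drinfeld_fil_set m.+1 x.
Proof.
by move=> [t mt ->]; exists t => // g; apply: free_deg_le_trans (mt g).
Qed.
Fact drinfeld_fil_exhaustive x : exists m, drinfeld_fil_set m x.
Proof.
have [y ->] := qpi_surj x.
exists (\max_(g : gT) \max_(w <- msupp (y g)) fdeg w)%N; exists y => // g w wy.
apply: leq_trans (leq_bigmax g).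
by rewrite (big_fsetD1 w) //= leq_maxl.
Qed.
Fact drinfeld_fil_1 : drinfeld_fil_set 0 1.
Proof.
exists 1; last by rewrite rmorph1.
move=> g; rewrite ffunE; case: eqP => _; first exact: free_deg_le1.
exact: free_deg_le0.
Qed.
Fact drinfeld_fil_M i j x y :
  drinfeld_fil_set i x -> drinfeld_fil_set j y -> drinfeld_fil_set (i + j) (x * y).
Proof.
move=> [t it ->] [u ju ->]; exists (t * u); last by rewrite rmorphM.
move=> g; rewrite ffunE; apply: free_deg_le_sum => h _.
by apply: free_deg_leM => //; apply: free_deg_le_act.
Qed.

Definition drinfeld_fil : filtration drinfeld :=
  Filtration drinfeld_fil_linear drinfeld_fil_incr drinfeld_fil_exhaustive
    drinfeld_fil_1 drinfeld_fil_M.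

Definition quantum_drinfeld_orbifold (actS : alg_action gT (qsym q)) : Prop :=
  exists Psi : {lrmorphism assoc_gr drinfeld_fil -> skew_group_alg actS},
    graded_iso (gr_comp (F := drinfeld_fil)) (@qsymG_comp actS) Psi.

End Drinfeld.

Section Deformation.
Variables (actS : alg_action gT (qsym q)) (U : algType k) (F : filtration U).

Definition pbw_deformation (Phi : {lrmorphism assoc_gr F -> skew_group_alg actS}) : Prop :=
  graded_iso (gr_comp (F := F)) (@qsymG_comp actS) Phi.

(* [kVG_group g] and [kVG_vect x g] are 1 tensor g and x tensor g.
   theta identifies (V tensor kG) + kG with F_1 U, compatibly with the
   identifications of F_0 U with kG and of F_1 U / F_0 U with V tensor kG that
   Phi provides. *)
Record deg1_identification (Phi : {lrmorphism assoc_gr F -> skew_group_alg actS})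
    (theta : {linear kVG -> U}) : Prop := {
  deg1_injective : injective theta;
  deg1_image : forall u, F 1%N u <-> exists w, u = theta w;
  deg1_group : forall g, exists Fg : F 0%N (theta (kVG_group g)),
    Phi (gr_class Fg) = skewt actS 1 g;
  deg1_symbol : forall w, exists Fw : F 1%N (theta w),
    Phi (gr_class Fw) = [ffun g => qsym_pi q (free_inj b (w g).2)];
  deg1_vect : forall x g,
    theta (kVG_vect x g) = theta (kVG_vect x 1%g) * theta (kVG_group g)
}.

Definition action_preserved (Phi : {lrmorphism assoc_gr F -> skew_group_alg actS}) : Prop :=
  exists2 theta, deg1_identification Phi theta &
    forall g x, theta (kVG_group g) * theta (kVG_vect x 1%g) =
                theta (kVG_vect (act g x) 1%g) * theta (kVG_group g).

End Deformation.

End Main.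

(* Main.v *)
Require Import Defs.
From HB Require Import structures.
From mathcomp Require Import all_boot all_fingroup all_algebra.
From mathcomp Require Import finmap monalg.

Set Implicit Arguments.
Unset Strict Implicit.
Unset Printing Implicit Defensive.

Import GRing.Theory.
Local Open Scope ring_scope.

(** The subspace F_1 U contains copies of V and of the group, and these
satisfy g v = (g v) g. The inclusions of V and G therefore extend to an algebra
morphism phi from T(V) x| G to U ([deformation_map]), and the point is to
determine its kernel.

The relator v_i v_j - q_ij v_j v_i is sent by phi into F_2 U, with symbol zero,
because the symbol of phi is the canonical projection onto S_q(V) x| G and the
relator vanishes in S_q(V). So its image lies in F_1 U, which is (k + V) # kG by
means of theta, and its coordinates there are, by definition, the value
kappa(v_i, v_j) ([kappa_exists]). Uniqueness of these coordinates turns the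
q-antisymmetry of the relators into that of kappa. By construction phi factors
through a morphism h from H_(q,kappa) to U.

Both algebras are filtered and h respects the filtrations. It maps each F_m H
onto F_m U, because any symbol in degree m lifts to a homogeneous element of
T(V) x| G, so that one may correct by induction on m ([phi_surj]). No part of
the filtration of H is lost either ([comparison_strict]): if the image of
y in degree m drops to F_(m-1) U, then the top component of y has symbol zero,
so its coefficients lie in the ideal generated by the relators. In H each relator
equals an element of degree at most 1, hence such a top component already drops
to F_(m-1) H ([drinfeld_lower]). Applied to elements of the kernel and
iterated down to F_(-1) H = 0, this gives the injectivity of h, and then h is an
isomorphism of filtered algebras. It induces an isomorphism of associated graded
algebras ([gr_iso]), which transports the PBW property from U to H.

All leading term arguments go through the relation [symbol], which is compatible
with sums and products and spares the handling of classes in gr U. *)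

(** * Algebra morphisms and quotients *)

Lemma lrmorphism_of (k : fieldType) (A B : algType k) (f : A -> B) :
  linear f -> monoid_morphism f -> exists phi : {lrmorphism A -> B}, phi =1 f.
Proof.
move=> fL fM.
pose lin := GRing.isLinear.Build k A B *:%R f fL.
pose mon := GRing.isMonoidMorphism.Build A B f fM.
by exists (HB.pack_for {lrmorphism A -> B} f lin mon).
Qed.

Lemma inj_surj_bij (A : choiceType) (B : eqType) (f : A -> B) :
  injective f -> (forall y, exists x, f x = y) -> bijective f.
Proof.
move=> fI fS.
have S y : exists x, f x == y by have [x <-] := fS y; exists x.
exists (fun y => xchoose (S y)) => [x|y]; last exact/eqP/(xchooseP (S y)).
exact/fI/eqP/(xchooseP (S (f x))).
Qed.

Lemma lrmorphism_inj (k : fieldType) (A B : algType k) (f : {lrmorphism A -> B}) :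
  (forall x, f x = 0 -> x = 0) -> injective f.
Proof.
by move=> f0 x y fxy; apply/subr0_eq/f0; rewrite raddfB /= fxy subrr.
Qed.

Lemma lrmorphism_inv (k : fieldType) (A B : algType k) (f : {lrmorphism A -> B}) :
  bijective f -> exists g : {lrmorphism B -> A}, cancel f g /\ cancel g f.
Proof.
move=> [g fg gf].
have gL : linear g.
  by move=> a x y; apply: (can_inj fg); rewrite gf linearP /= !gf.
have gM : monoid_morphism g.
  by split=> [|x y]; apply: (can_inj fg); rewrite gf ?rmorph1 ?rmorphM /= ?gf.
have [h hg] := lrmorphism_of gL gM.
by exists h; split=> x; rewrite hg.
Qed.

Lemma quot_lift (k : fieldType) (A B : algType k) (I : ideal A)
    (hI : is_proper I) (f : {lrmorphism A -> B}) :
  (forall x, I x -> f x = 0) ->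
  exists h : {lrmorphism quot_alg hI -> B}, forall x, h (qpi hI x) = f x.
Proof.
move=> If.
pose h (u : quot_alg hI) : B := f (generic_quotient.repr u).
have hE x : h (qpi hI x) = f x.
  apply/subr0_eq; rewrite -rmorphB; apply/If/(qpiP hI).
  by rewrite /qpi generic_quotient.reprK.
have hL : linear h.
  move=> a; elim/qpi_ind=> x; elim/qpi_ind=> y.
  by rewrite -linearP !hE linearP.
have hM : monoid_morphism h.
  split; first exact: etrans (hE 1) (rmorph1 f).
  elim/qpi_ind=> x; elim/qpi_ind=> y.
  by rewrite -rmorphM !hE rmorphM.
have [g gh] := lrmorphism_of hL hM.
by exists g => x; rewrite gh.
Qed.

Lemma qpi_eq0 (k : fieldType) (A : algType k) (I : ideal A) (hI : is_proper I) x :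
  qpi hI x = 0 <-> I x.
Proof. by rewrite -(raddf0 (qpi hI)) qpiP subr0. Qed.

Lemma ideal_gen_mem (k : fieldType) (A : algType k) (X : A -> Prop) x :
  X x -> ideal_gen X x.
Proof. by move=> Xx I; apply. Qed.

(** A kernel is an ideal, so it contains the ideal generated by X as soon as it
contains X. *)
Lemma ideal_gen_ker (k : fieldType) (A B : algType k) (X : A -> Prop)
    (f : {lrmorphism A -> B}) :
  (forall x, X x -> f x = 0) -> forall x, ideal_gen X x -> f x = 0.
Proof.
move=> Xf x; have K0 : f 0 = 0 by rewrite rmorph0.
have KD y z : f y = 0 -> f z = 0 -> f (y + z) = 0.
  by rewrite rmorphD /= => -> ->; rewrite addr0.
have KMl a y : f y = 0 -> f (a * y) = 0 by rewrite rmorphM /= => ->; rewrite mulr0.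
have KMr a y : f y = 0 -> f (y * a) = 0 by rewrite rmorphM /= => ->; rewrite mul0r.
move=> Gx; pose K := @Ideal k A (fun y => f y = 0) K0 KD KMl KMr.
exact: (Gx K Xf).
Qed.

(** * Symbols in the associated graded algebra *)

Section Symbol.
Variables (k : fieldType) (A : algType k) (F : filtration A).
Variables (S : algType k) (Phi : {lrmorphism assoc_gr F -> S}).

(** The leading term of x in degree m, read in S along Phi. The relational form
keeps the proof of membership in F_m, on which the class of x depends, out of
the statements. *)
Definition symbol m x s := exists Fx : F m x, Phi (gr_class Fx) = s.

Lemma gr_class_eq0 m x (Fx : F m x) : gr_class Fx = 0 <-> fil_pred F m x.
Proof.
rewrite qpi_eq0 /=; split=> [/(_ m)|Px i].
  by rewrite coefZ coefXn eqxx mulr1.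
rewrite coefZ coefXn; case: eqP => [->|_]; rewrite ?mulr1 ?mulr0 //.
exact: fil_pred0.
Qed.

Lemma symbol_fil m x s : symbol m x s -> F m x.
Proof. by case. Qed.

Lemma symbol1 : symbol 0 1 1.
Proof.
exists (fil_1 F); rewrite -[RHS](rmorph1 Phi); congr (Phi _).
rewrite -[RHS](rmorph1 (qpi _)); congr (qpi _ _).
by apply/val_inj; rewrite /= expr0 alg_polyC.
Qed.

Lemma symbol0 m : symbol m 0 0.
Proof.
exists (fil0 F m); rewrite (_ : gr_class _ = 0) ?rmorph0 //.
exact/gr_class_eq0/fil_pred0.
Qed.

Lemma symbol_lin m (a : k) x y s t :
  symbol m x s -> symbol m y t -> symbol m (a *: x + y) (a *: s + t).
Proof.
move=> [Fx <-] [Fy <-]; exists (fil_linear a Fx Fy).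
rewrite -linearP -[in RHS]linearP; congr (Phi (qpi _ _)); apply/val_inj => /=.
by rewrite scalerDl scalerA mulr_algl.
Qed.

Lemma symbolD m x y s t : symbol m x s -> symbol m y t -> symbol m (x + y) (s + t).
Proof. by move=> sx sy; rewrite -[x]scale1r -[s]scale1r; apply: symbol_lin. Qed.

Lemma symbolZ m (a : k) x s : symbol m x s -> symbol m (a *: x) (a *: s).
Proof.
by move=> sx; rewrite -[a *: x]addr0 -[a *: s]addr0; apply/symbol_lin/symbol0.
Qed.

Lemma symbolB m x y s t : symbol m x s -> symbol m y t -> symbol m (x - y) (s - t).
Proof.
by move=> sx sy; rewrite addrC [s - t]addrC -!scaleN1r; apply: symbol_lin.
Qed.

Lemma symbol_sum m (J : Type) (r : seq J) (P : pred J) f g :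
  (forall i, P i -> symbol m (f i) (g i)) ->
  symbol m (\sum_(i <- r | P i) f i) (\sum_(i <- r | P i) g i).
Proof.
by move=> fg; apply: (big_rec2 (symbol m)) => [|i x s /fg]; [apply: symbol0 | apply: symbolD].
Qed.

Lemma symbolM i j x y s t :
  symbol i x s -> symbol j y t -> symbol (i + j) (x * y) (s * t).
Proof.
move=> [Fx <-] [Fy <-]; exists (fil_M Fx Fy).
rewrite -rmorphM -[in RHS]rmorphM; congr (Phi (qpi _ _)); apply/val_inj => /=.
rewrite -!mul_polyC polyCM exprD !mulrA; congr (_ * _).
by rewrite -!mulrA; congr (_ * _); apply: commr_polyXn.
Qed.

Lemma fil_pred_symbol m x : fil_pred F m x -> symbol m x 0.
Proof.
move=> Px.
have Fx : F m x.
  by case: m Px => [->|m Px]; [apply: fil0 | apply: fil_incr].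
by exists Fx; have /gr_class_eq0-> := Px; rewrite rmorph0.
Qed.

Lemma symbol_uniq m x s t : symbol m x s -> symbol m x t -> s = t.
Proof.
move=> sx tx; have := symbolB sx tx; rewrite subrr => -[F0 e].
apply/subr0_eq; rewrite -e (_ : gr_class F0 = 0) ?rmorph0 //.
exact/gr_class_eq0/fil_pred0.
Qed.

Hypothesis PhiI : injective Phi.

Lemma symbol_eq0 m x : symbol m x 0 -> fil_pred F m x.
Proof.
by move=> [Fx Phi0]; apply/(gr_class_eq0 Fx)/PhiI; rewrite Phi0 rmorph0.
Qed.

Lemma symbol_inj m x y s : symbol m x s -> symbol m y s -> fil_pred F m (x - y).
Proof. by move=> sx sy; apply: symbol_eq0; rewrite -[0](subrr s); apply: symbolB. Qed.

End Symbol.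

(** * Symbols of values of a morphism from the free algebra *)

Section FreeSymbol.
Variables (k : fieldType) (n : nat).
Local Notation T := (free_alg k n).

Lemma free_homogD m (t u : T) :
  free_homog m t -> free_homog m u -> free_homog m (t + u).
Proof.
move=> mt mu w /(fsubsetP (msuppD_le _ _)).
by rewrite in_fsetU => /orP[/mt|/mu].
Qed.

Lemma free_homogZ m a (t : T) : free_homog m t -> free_homog m (a *: t).
Proof. by move=> mt w /(fsubsetP (msuppZ_le _ _)) /mt. Qed.

(** The case distinction on m mirrors the convention F_(-1) = 0, so that the lower
part t1 lands in [fil_pred] under any filtered map. *)
Lemma free_split m (t : T) : free_deg_le m t ->
  exists t0 t1, [/\ t = t0 + t1, free_homog m t0 &
    if m is m'.+1 then free_deg_le m' t1 else t1 = 0].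
Proof.
move=> mt; rewrite [t]free_expand (bigID (fun w => fdeg w == m)) /=.
set t0 := \sum_(_ <- _ | _) _; set t1 := \sum_(_ <- _ | _) _.
exists t0, t1; split=> //.
  rewrite /t0; apply: big_ind => [w||w /eqP wm].
  - by rewrite msupp0 in_fset0.
  - exact: free_homogD.
  by apply: free_homogZ => w'; rewrite msuppU1 in_fset1 => /eqP->.
case: m mt @t0 @t1 => [|m] mt /=.
  rewrite big_seq_cond big1 // => w /andP[/mt].
  by rewrite leqn0 => ->.
rewrite big_seq_cond; apply: free_deg_le_sum => w /andP[/mt wm wnm].
apply: free_deg_leZ => w'; rewrite msuppU1 in_fset1 => /eqP->.
by rewrite -ltnS ltn_neqAle wnm wm.
Qed.

Variables (A : algType k) (F : filtration A) (f : {lrmorphism T -> A}).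

Lemma fil_free m t : (forall i, F 1%N (f (free_gen k i))) ->
  free_deg_le m t -> F m (f t).
Proof.
move=> F1 mt; rewrite [t]free_expand raddf_sum big_seq.
apply: fil_sum => w /mt wm; rewrite /= linearZ /= free_word rmorph_prod.
apply: filZ; apply: fil_le wm _; rewrite /fdeg.
elim: (w : seq _) => [|i s IH]; first by rewrite big_nil; apply: fil_1.
rewrite big_cons -[size _]/(1 + size s)%N; exact: fil_M (F1 i) IH.
Qed.

Variables (S : algType k) (Phi : {lrmorphism assoc_gr F -> S}).
Variable s : {lrmorphism T -> S}.
Hypothesis fs : forall i, symbol Phi 1 (f (free_gen k i)) (s (free_gen k i)).

(** Multiplicativity of symbols propagates the agreement on generators to all
words, and homogeneity puts all words of t in the same degree. *)
Lemma symbol_free m t : free_homog m t -> symbol Phi m (f t) (s t).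
Proof.
move=> mt; rewrite [t]free_expand !raddf_sum !big_seq.
apply: symbol_sum => w /mt <-; rewrite /= !linearZ /= free_word !rmorph_prod.
apply: symbolZ; rewrite /fdeg.
elim: (w : seq _) => [|i r IH]; first by rewrite !big_nil; apply: symbol1.
rewrite !big_cons -[size _]/(1 + size r)%N; exact: symbolM (fs i) IH.
Qed.

End FreeSymbol.

(** * Functoriality of the associated graded algebra *)

Section GrMap.
Variables (k : fieldType) (A B : algType k).
Variables (FA : filtration A) (FB : filtration B) (f : {lrmorphism A -> B}).

(** The map of Rees rings is the coefficientwise application of f; it respects
the ideals defining the associated graded algebras. *)
Lemma gr_map : (forall m x, FA m x -> FB m (f x)) ->
  exists h : {lrmorphism assoc_gr FA -> assoc_gr FB},
    forall p q : rees _,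
      rees_poly q = map_poly f (rees_poly p) -> h (qpi _ p) = qpi _ q.
Proof.
move=> fF.
have reesf (p : rees FA) : map_poly f p \in rees_mem FB.
  by apply/rees_memP => m; rewrite coef_map; apply/fF/rees_coef.
pose R (p : rees FA) : rees FB := Rees (reesf p).
have RL : linear R.
  move=> a p q; apply/val_inj; rewrite /= rmorphD; congr (_ + _).
  by apply/polyP=> i; rewrite !(coefZ, coef_map) /= !mulr_algl linearZ.
have RM : monoid_morphism R.
  by split=> [|p q]; apply/val_inj; rewrite /= ?rmorph1 ?rmorphM.
have [g gR] := lrmorphism_of RL RM.
have [|h hE] := @quot_lift _ _ _ _ (@gr_ideal_proper _ _ FA)
  (qpi (@gr_ideal_proper _ _ FB) \o g).
  move=> p Ip /=; apply/qpi_eq0 => m; rewrite gR /= coef_map.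
  case: m (Ip m) => [->|m Fm] /=; [exact: rmorph0 | exact: fF].
exists h => p q e; rewrite hE /= gR; congr (qpi _ _).
exact/val_inj/esym.
Qed.

(** A filtered bijection need not be a graded isomorphism: the second hypothesis,
that F_m is mapped onto F_m, makes the inverse filtered as well. *)
Lemma gr_iso : (forall m x, FA m x -> FB m (f x)) ->
  (forall m y, FB m y -> exists2 x, FA m x & f x = y) -> injective f ->
  exists h : {lrmorphism assoc_gr FA -> assoc_gr FB},
    graded_iso (gr_comp (F := FA)) (gr_comp (F := FB)) h.
Proof.
move=> fF Ff fI; have [h hE] := gr_map fF; exists h.
have fF' m x : FB m (f x) -> FA m x by move=> /Ff[x' Fx' /fI<-].
have hI : injective h.
  apply: lrmorphism_inj; elim/qpi_ind=> p.
  have reesf : map_poly f p \in rees_mem FB.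
    by apply/rees_memP => m; rewrite coef_map; apply/fF/rees_coef.
  rewrite (hE p (Rees reesf)) // => /qpi_eq0 Ip; apply/qpi_eq0 => m.
  move: (Ip m); rewrite /= coef_map; case: m => [|m] /=; last exact: fF'.
  by rewrite -(rmorph0 f) => /fI.
have fS y : exists x, f x = y.
  by have [m /Ff[x _ <-]] := fil_exhaustive FB y; exists x.
have [g [fg gf]] := lrmorphism_inv (inj_surj_bij fI fS).
have hgr m x (Fx : FA m x) (Ffx : FB m (f x)) : h (gr_class Fx) = gr_class Ffx.
  by apply: hE; rewrite /= -!mul_polyC rmorphM /= map_polyC map_polyXn.
split=> [|m u].
  apply: inj_surj_bij => //; elim/qpi_ind=> p.
  have reesg : map_poly g p \in rees_mem FA.
    by apply/rees_memP => m; apply: fF'; rewrite coef_map /= gf; apply: rees_coef.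
  exists (qpi _ (Rees reesg)); apply: hE; rewrite /= -map_poly_comp.
  by rewrite map_poly_id // => x _ /=; rewrite gf.
split=> [[x [Fx ->]]|[y [Fy]]]; first by exists (f x), (fF _ _ Fx); apply: hgr.
have [x Fx fxy] := Ff _ _ Fy; case: _ / fxy Fy => Ffx.
by rewrite -(hgr _ _ Fx) => /hI->; exists x, Fx.
Qed.

End GrMap.

(** * Skew group algebras *)

Section SkewExt.
Variables (k : fieldType) (gT : finGroupType) (A : algType k).
Variable act : alg_action gT A.
Local Notation S := (skew_group_alg act).

Lemma skewt_linear g : linear (skewt act ^~ g).
Proof.
move=> a x y; apply/ffunP=> h; rewrite !ffunE.
by case: eqP => _; rewrite ?scaler0 ?addr0.
Qed.

Lemma skewtM r s g h :
  skewt act r g * skewt act s h = skewt act (r * act g s) (g * h)%g.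
Proof. exact: skew_mul_tens. Qed.

Lemma skew_decomp (y : S) : y = \sum_g skewt act (y g) g.
Proof.
apply/ffunP=> x; rewrite sum_ffunE (bigD1 x) //= ffunE eqxx big1 ?addr0 //.
by move=> g /negbTE gx; rewrite ffunE eq_sym gx.
Qed.

Lemma skew_base : exists iota : {lrmorphism A -> S}, forall x, iota x = skewt act x 1%g.
Proof.
have [|iota iotaE] := lrmorphism_of (skewt_linear 1%g); last by exists iota.
by split=> // x y; rewrite skewtM alg_act1 mulg1.
Qed.

(** The universal property of the skew group algebra: c is a multiplicative map
implementing the action on the image of f by commutation. *)
Lemma skew_ext (B : algType k) (f : {lrmorphism A -> B}) (c : gT -> B) :
  c 1%g = 1 -> (forall g h, c (g * h)%g = c g * c h) ->
  (forall g x, c g * f x = f (act g x) * c g) ->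
  exists phi : {lrmorphism S -> B}, forall y, phi y = \sum_g f (y g) * c g.
Proof.
move=> c1 cM cf; pose phi (y : S) := \sum_g f (y g) * c g.
have phiL : linear phi.
  move=> a x y; rewrite scaler_sumr -big_split; apply: eq_bigr => g _ /=.
  by rewrite !ffunE linearP mulrDl scalerAl.
have phit x g : phi (skewt act x g) = f x * c g.
  rewrite /phi (bigD1 g) //= ffunE eqxx big1 ?addr0 // => h /negbTE hg.
  by rewrite ffunE hg rmorph0 mul0r.
have phiM : monoid_morphism phi.
  split; first by rewrite (phit 1 1%g) rmorph1 c1 mulr1.
  pose psi : {linear S -> B} := HB.pack_for {linear S -> B} phi
    (GRing.isLinear.Build k S B *:%R phi phiL).
  move=> x y; rewrite -[phi _]/(psi _) -[phi x]/(psi x) -[phi y]/(psi y).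
  (* By bilinearity it suffices to multiply elements supported at one point. *)
  rewrite [x in LHS]skew_decomp mulr_suml [x in RHS]skew_decomp !linear_sum.
  rewrite mulr_suml; apply: eq_bigr => g _.
  rewrite [y in LHS]skew_decomp mulr_sumr [y in RHS]skew_decomp !linear_sum.
  rewrite mulr_sumr; apply: eq_bigr => h _.
  rewrite skewtM /= !phit rmorphM cM -!mulrA; congr (_ * _).
  by rewrite !mulrA cf.
have [g gE] := lrmorphism_of phiL phiM.
by exists g => y; rewrite gE.
Qed.

End SkewExt.

(** * Comparison of a deformation with a quantum Drinfeld orbifold algebra *)

Section Comparison.
Variables (k : fieldType) (n : nat) (V : vectType k) (b : n.-tuple V).
Hypothesis hb : basis_of fullv b.
Variables (q : 'I_n -> 'I_n -> k).
Hypothesis q_neq0 : forall i j, q i j != 0.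
Hypothesis q_inv : forall i j, q j i = (q i j)^-1.
Variables (gT : finGroupType) (act : lin_action gT V).
Variables (actS : alg_action gT (qsym q)).
Local Notation T := (free_alg k n).
Local Notation TG := (skew_group_alg (tensor_act act hb)).
Local Notation S := (skew_group_alg actS).
Local Notation v := (free_gen k).

Lemma kVG_vect_linear g : linear ((@kVG_vect k V gT) ^~ g).
Proof.
move=> a x y; apply/ffunP=> h; rewrite !ffunE.
by case: eqP => _; rewrite ?scaler0 ?addr0 //; congr pair; rewrite /= ?scaler0 ?addr0.
Qed.

Lemma kVG_decomp (w : kVG V gT) :
  w = \sum_g ((w g).1 *: kVG_group V g + kVG_vect (w g).2 g).
Proof.
apply/ffunP=> x; rewrite sum_ffunE (bigD1 x) //= !ffunE eqxx big1 ?addr0.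
  case: (w x) => c u; congr pair; rewrite /= ?scaler0 ?add0r //.
  by rewrite addr0 [_ *: _]mulr1.
by move=> g /negbTE gx; rewrite !ffunE eq_sym gx scaler0 addr0.
Qed.

Lemma kVG_incl_deg w : skew_deg_le 1 (kVG_incl hb act w).
Proof.
move=> g; rewrite ffunE; apply: free_deg_leD; last exact: free_deg_le_inj.
by apply: free_deg_leZ; apply: free_deg_le_trans (@free_deg_le1 k n).
Qed.

(** Moving c past a word one letter at a time, it is enough to know how c commutes
with vectors. *)
Lemma free_commute (B : algType k) (f : {lrmorphism T -> B}) (g : gT) (c : B) :
  (forall x, c * f (free_inj b x) = f (free_inj b (act g x)) * c) ->
  forall t, c * f t = f (tensor_act act hb g t) * c.
Proof.
move=> cV; have := tensor_act_inj act hb g.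
rewrite -[tensor_act_fun b act g]/(tensor_act act hb g).
(* The automorphism is only used through its values on vectors; kept opaque, it
   is not expanded on words. *)
move: (tensor_act act hb g) => a aE t.
rewrite [t]free_expand !raddf_sum mulr_sumr mulr_suml.
apply: eq_bigr => w _; rewrite /= !linearZ /= -scalerAr -scalerAl; congr (_ *: _).
rewrite free_word !rmorph_prod.
elim: (w : seq _) => [|i s IH]; first by rewrite !big_nil mul1r mulr1.
rewrite !big_cons mulrA -(free_inj_basis hb i) cV.
by rewrite -mulrA IH mulrA /= aE.
Qed.

Definition qsym_relator i j : T := v i * v j - q i j *: (v j * v i).

Lemma qsym_relator_anti i j : qsym_relator i j = - q i j *: qsym_relator j i.
Proof.
have twist (M : lmodType k) (c d : k) (x y : M) :
    c * d = 1 -> x - c *: y = - c *: (y - d *: x).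
  by move=> cd; rewrite scalerBr scalerA mulNr cd scaleN1r opprK scaleNr addrC.
by apply: twist; rewrite (q_inv i j) divff.
Qed.

Lemma map_qsym_relator (B : algType k) (h : {lrmorphism T -> B}) i j :
  h (qsym_relator i j) = h (v i) * h (v j) - q i j *: (h (v j) * h (v i)).
Proof.
rewrite /qsym_relator raddfB; congr (_ - _); first exact: rmorphM.
by rewrite /= linearZ; congr (_ *: _); apply: rmorphM.
Qed.

Section Orbifold.
Variable kappa : V -> V -> kVG V gT.
Hypothesis hp : is_proper (drinfeld_ideal hb act q kappa).
Local Notation FH := (drinfeld_fil hp).

Lemma drinfeld_group g : FH 0 (drinfeld_pi hp (skewt _ 1 g)).
Proof.
exists (skewt _ 1 g) => // h; rewrite ffunE.
by case: eqP => _; [apply: free_deg_le1 | apply: free_deg_le0].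
Qed.

(** In gr H the classes of the generators satisfy the relations of S_q(V), since
kappa takes values in degree at most 1. So the induced map from T(V) to gr H kills
the whole ideal of relations, and computes the symbol of a homogeneous t. *)
Lemma drinfeld_lower m t g : free_homog m t -> ideal_gen (qsym_rel q) t ->
  fil_pred FH m (drinfeld_pi hp (skewt _ t g)).
Proof.
move=> mt It; have [iota iotaE] := skew_base (tensor_act act hb).
pose f : {lrmorphism T -> drinfeld hp} := drinfeld_pi hp \o iota.
have F1 i : FH 1 (f (v i)).
  exists (iota (v i)) => // h; rewrite iotaE ffunE.
  by case: eqP => _; [apply: free_deg_le_gen | apply: free_deg_le0].
pose s : {lrmorphism T -> assoc_gr FH} := free_ext (fun i => gr_class (F1 i)).
have fs i : symbol (idfun : {lrmorphism assoc_gr FH -> assoc_gr FH}) 1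
    (f (v i)) (s (v i)).
  by exists (F1 i); exact: esym (free_ext_gen _ _).
have s_rel i j : s (qsym_relator i j) = 0.
  (* Two symbols of the same element: one by multiplicativity, and 0 because the
     relator is equal to a value of kappa. *)
  apply: (@symbol_uniq _ _ FH _ idfun 2 (f (qsym_relator i j))).
    rewrite !map_qsym_relator.
    by apply: symbolB; [|apply: symbolZ]; apply: (@symbolM _ _ _ _ _ 1 1).
  apply: fil_pred_symbol.
  exists (kVG_incl hb act (kappa (tnth b i) (tnth b j))); first exact: kVG_incl_deg.
  apply/qpiP; apply: ideal_gen_mem; exists i, j.
  by rewrite map_qsym_relator !iotaE !(free_inj_basis hb).
have st : s t = 0 by apply: (ideal_gen_ker _ It) => _ [i [j ->]]; apply: s_rel.
have fil_ft : fil_pred FH m (f t).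
  by apply: (@symbol_eq0 _ _ _ _ idfun) => //; rewrite -st; apply: symbol_free.
rewrite (_ : skewt _ t g = iota t * skewt _ 1 g).
  by rewrite rmorphM -[m]addn0; apply: fil_pred_Mr (drinfeld_group g).
by rewrite iotaE skewtM rmorph1 mulr1 mul1g.
Qed.

End Orbifold.

Section Deformation.
Variables (U : algType k) (F : filtration U).
Variable Phi : {lrmorphism assoc_gr F -> S}.
Hypothesis hU : pbw_deformation Phi.
Variable theta : {linear kVG V gT -> U}.
Hypothesis theta_id : deg1_identification b Phi theta.
Hypothesis theta_act : forall g x,
  theta (kVG_group V g) * theta (kVG_vect x 1%g) =
  theta (kVG_vect (act g x) 1%g) * theta (kVG_group V g).

Let PhiI : injective Phi := bij_inj hU.1.

Lemma symbol_group g : symbol Phi 0 (theta (kVG_group V g)) (skewt actS 1 g).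
Proof. by have [Fg e] := deg1_group theta_id g; exists Fg. Qed.

(** In degree 0 the symbol determines the element, as F_(-1) = 0; so the group
laws, true in S_q(V) x| G, hold in U. *)
Lemma theta_groupM g h :
  theta (kVG_group V (g * h)%g) = theta (kVG_group V g) * theta (kVG_group V h).
Proof.
apply/subr0_eq/(symbol_inj PhiI (symbol_group _)).
have := symbolM (symbol_group g) (symbol_group h).
by rewrite skewtM rmorph1 mulr1.
Qed.

Lemma theta_group1 : theta (kVG_group V 1%g) = 1.
Proof. exact/subr0_eq/(symbol_inj PhiI (symbol_group _))/symbol1. Qed.

Lemma free_inj_theta x :
  free_ext (fun i => theta (kVG_vect (tnth b i) 1%g)) (free_inj b x) =
  theta (kVG_vect x 1%g).
Proof.
pose e y := @kVG_vect k V gT y 1%g.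
pose vect := HB.pack_for {linear V -> kVG V gT} e
  (GRing.isLinear.Build k V (kVG V gT) *:%R e (kVG_vect_linear 1%g)).
rewrite -[kVG_vect x 1%g]/(vect x) [in RHS](coord_basis hb (memvf x)).
rewrite !linear_sum; apply: eq_bigr => i _.
by rewrite !linearZ /= free_ext_gen (tnth_nth 0).
Qed.

(** The hypothesis that the action is preserved is what makes the inclusions of V
and G compatible with the multiplication of the skew group algebra. *)
Lemma deformation_map : exists f : {lrmorphism T -> U},
  exists phi : {lrmorphism TG -> U},
  [/\ forall i, f (v i) = theta (kVG_vect (tnth b i) 1%g),
      forall y, phi y = \sum_g f (y g) * theta (kVG_group V g)
    & forall w, phi (kVG_incl hb act w) = theta w].
Proof.
pose f : {lrmorphism T -> U} :=
  free_ext (fun i => theta (kVG_vect (tnth b i) 1%g)).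
have fE x : f (free_inj b x) = theta (kVG_vect x 1%g) by exact: free_inj_theta.
have [|phi phiE] :=
  skew_ext theta_group1 theta_groupM (act := tensor_act act hb) (f := f).
  by move=> g; apply: free_commute => x; rewrite !fE theta_act.
exists f, phi; split=> // [i|w]; first exact: free_ext_gen.
rewrite phiE [in RHS](kVG_decomp w) linear_sum; apply: eq_bigr => g _ /=.
rewrite ffunE !linearD /= !linearZ /= rmorph1 fE mulrDl mulr_algl.
by rewrite [in RHS](deg1_vect theta_id).
Qed.

Variables (f : {lrmorphism T -> U}) (phi : {lrmorphism TG -> U}).
Hypothesis f_gen : forall i, f (v i) = theta (kVG_vect (tnth b i) 1%g).
Hypothesis phiE : forall y, phi y = \sum_g f (y g) * theta (kVG_group V g).
Hypothesis phi_incl : forall w, phi (kVG_incl hb act w) = theta w.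

Lemma phi_skewt t g : phi (skewt _ t g) = f t * theta (kVG_group V g).
Proof.
rewrite phiE (bigD1 g) //= ffunE eqxx big1 ?addr0 // => h /negbTE hg.
by rewrite ffunE hg rmorph0 mul0r.
Qed.

Lemma symbol_gen i : symbol Phi 1 (f (v i)) (skewt actS (qsym_pi q (v i)) 1%g).
Proof.
rewrite f_gen; have [Fw e] := deg1_symbol theta_id (kVG_vect (tnth b i) 1%g).
exists Fw; rewrite e; apply/ffunP=> g; rewrite !ffunE; case: eqP => _ /=.
  by rewrite free_inj_basis.
by rewrite !raddf0.
Qed.

Lemma symbol_free_qsym m t : free_homog m t ->
  symbol Phi m (f t) (skewt actS (qsym_pi q t) 1%g).
Proof.
have [iota iotaE] := skew_base actS.
have /symbol_free s i : symbol Phi 1 (f (v i)) ((iota \o qsym_pi q) (v i)).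
  by rewrite /= iotaE; apply: symbol_gen.
by rewrite -iotaE; apply: s.
Qed.

Lemma symbol_phi m (y : TG) : (forall g, free_homog m (y g)) ->
  symbol Phi m (phi y) [ffun g => qsym_pi q (y g)].
Proof.
move=> my; rewrite phiE [X in symbol _ _ _ X](skew_decomp (act := actS)).
apply: symbol_sum => g _; rewrite ffunE -[m]addn0.
have := symbolM (symbol_free_qsym (my g)) (symbol_group g).
by rewrite skewtM rmorph1 mulr1 mul1g.
Qed.

Lemma phi_fil m (y : TG) : skew_deg_le m y -> F m (phi y).
Proof.
move=> my; rewrite phiE; apply: fil_sum => g _; rewrite -[m]addn0.
apply: fil_M (symbol_fil (symbol_group g)); apply: fil_free (my g) => i.
exact: symbol_fil (symbol_gen i).
Qed.

(** Phi identifies gr_m U with the degree m part of S_q(V) x| G, whose elements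
lift to homogeneous elements over T(V); the lift has the same image as u. *)
Lemma phi_top m u : F m u ->
  exists2 y : TG, (forall g, free_homog m (y g)) & fil_pred F m (u - phi y).
Proof.
move=> Fu; have /(hU.2 _ _).1 top : gr_comp m (gr_class Fu) by exists u, Fu.
have [t mt pit] := fin_all_exists2 top.
pose y : TG := finfun t; have my g : free_homog m (y g) by rewrite ffunE; apply: mt.
exists y => //; apply: (symbol_inj PhiI _ (symbol_phi my)).
by exists Fu; apply/ffunP=> g; rewrite !ffunE.
Qed.

Lemma phi_surj m u : F m u -> exists2 y : TG, skew_deg_le m y & u = phi y.
Proof.
elim: m u => [|m IH] u /phi_top[y my] /=.
  by move=> /subr0_eq->; exists y => // g w /my->.
move=> /IH[z mz zE]; exists (z + y); last by rewrite rmorphD /= -zE subrK.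
move=> g; rewrite ffunE; apply: free_deg_leD => w; first by move/mz; apply: leqW.
by move/my->.
Qed.

(** The image lies a priori in F_2 U, but its symbol there is a relation of
S_q(V), hence zero. *)
Lemma phi_relation i j :
  exists w, phi (skewt _ (qsym_relator i j) 1%g) = theta w.
Proof.
apply/(deg1_image theta_id); rewrite phi_skewt theta_group1 mulr1.
apply: (@symbol_eq0 _ _ _ _ _ PhiI 2).
have [iota iotaE] := skew_base actS.
pose s : {lrmorphism T -> S} := iota \o qsym_pi q.
have fs l : symbol Phi 1 (f (v l)) (s (v l)).
  by rewrite /s /= iotaE; apply: symbol_gen.
have s0 : s (qsym_relator i j) = 0.
  rewrite /s /= (_ : qsym_pi q _ = 0) ?rmorph0 //.
  by apply/qpi_eq0/ideal_gen_mem; exists i, j.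
suff: symbol Phi 2 (f (qsym_relator i j)) (s (qsym_relator i j)).
  by rewrite s0.
rewrite !map_qsym_relator.
by apply: symbolB; [|apply: symbolZ]; apply: (@symbolM _ _ _ _ _ 1 1).
Qed.

Lemma kappa_exists : exists kappa : V -> V -> kVG V gT,
  [/\ (forall x, linear (kappa x)) /\ (forall y, linear (kappa ^~ y)),
      forall i j, kappa (tnth b i) (tnth b j) =
                  - q i j *: kappa (tnth b j) (tnth b i)
    & forall y : TG, drinfeld_rel q kappa y -> phi y = 0].
Proof.
have [iota iotaE] := skew_base (tensor_act act hb).
(* w (i, j) is the value forced on kappa(v_i, v_j); kappa extends it bilinearly. *)
have [w wE] := fin_all_exists (fun ij : 'I_n * 'I_n => phi_relation ij.1 ij.2).
have wE' i j : theta (w (i, j)) = phi (iota (qsym_relator i j)).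
  by rewrite iotaE -(wE (i, j)).
pose kappa x y := \sum_ij (coord b ij.1 x * coord b ij.2 y) *: w ij.
have kappa_b i j : kappa (tnth b i) (tnth b j) = w (i, j).
  rewrite /kappa (bigD1 (i, j)) //= big1 ?addr0.
    by rewrite !(tnth_nth 0) !coord_free ?(basis_free hb) // !eqxx mulr1 scale1r.
  case=> i' j'; rewrite xpair_eqE negb_and => ij /=.
  rewrite !(tnth_nth 0) !coord_free ?(basis_free hb) //=.
  by case/orP: ij; rewrite eq_sym -val_eqE /= => /negbTE->; rewrite ?mulr0 ?mul0r scale0r.
exists kappa; split.
- split=> [x a y z|y a x z]; rewrite /kappa scaler_sumr -big_split;
    apply: eq_bigr => ij _ /=.
    by rewrite linearP mulrDr scalerDl scalerA; congr (_ *: _ + _); rewrite mulrCA.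
  by rewrite linearP mulrDl scalerDl scalerA mulrA.
- move=> i j; rewrite !kappa_b; apply: (deg1_injective theta_id).
  have phiZ c t : phi (iota (c *: t)) = c *: phi (iota t) by rewrite !linearZ.
  by rewrite linearZ /= !wE' -phiZ -qsym_relator_anti.
move=> y [i [j ->]]; rewrite raddfB /= phi_incl kappa_b wE'.
by rewrite /= !(free_inj_basis hb) -!iotaE -map_qsym_relator subrr.
Qed.
Section Isomorphism.
Variable kappa : V -> V -> kVG V gT.
Hypothesis phi_rel : forall y : TG, drinfeld_rel q kappa y -> phi y = 0.

Lemma drinfeld_proper : is_proper (drinfeld_ideal hb act q kappa).
Proof.
by move=> /(ideal_gen_ker phi_rel)/eqP; rewrite rmorph1 oner_eq0.
Qed.

Variable hp : is_proper (drinfeld_ideal hb act q kappa).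
Variable h : {lrmorphism drinfeld hp -> U}.
Hypothesis h_pi : forall y, h (drinfeld_pi hp y) = phi y.
Local Notation FH := (drinfeld_fil hp).

(** The top component of y has symbol zero in U, so its coefficients are
combinations of relators, and these have lower degree in H. *)
Lemma comparison_strict m x : FH m x -> fil_pred F m (h x) -> fil_pred FH m x.
Proof.
move=> [y my ->]; rewrite h_pi => phi_y.
have split g : exists t : T * T, [/\ y g = t.1 + t.2, free_homog m t.1 &
    if m is m'.+1 then free_deg_le m' t.2 else t.2 = 0].
  by have [t0 [t1 ?]] := free_split (my g); exists (t0, t1).
have [t tE] := fin_all_exists split.
pose y0 : TG := [ffun g => (t g).1]; pose y1 : TG := [ffun g => (t g).2].
have yE : y = y0 + y1 by apply/ffunP=> g; rewrite !ffunE; case: (tE g).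
have y0h g : free_homog m (y0 g) by rewrite ffunE; case: (tE g).
have y1F : fil_pred FH m (drinfeld_pi hp y1).
  case: m {my phi_y split y0h} tE => [|m] tE /=.
    rewrite (_ : y1 = 0) ?rmorph0 //.
    by apply/ffunP=> g; rewrite !ffunE; case: (tE g).
  by exists y1 => // g; rewrite ffunE; case: (tE g).
rewrite yE rmorphD; apply: fil_predD => //.
have phi_y0 : fil_pred F m (phi y0).
  have -> : phi y0 = phi y + - phi y1 by rewrite yE rmorphD addrK.
  apply: fil_predD => //; rewrite -scaleN1r.
  case: m {my phi_y split y0h} tE y1F => [|m] tE y1F /=.
    by rewrite -h_pi y1F rmorph0 scaler0.
  by apply/filZ/phi_fil => g; rewrite ffunE; case: (tE g).
have /ffunP s0 := symbol_uniq (symbol_phi y0h) (fil_pred_symbol Phi phi_y0).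
rewrite [y0](skew_decomp (act := tensor_act act hb)) rmorph_sum.
apply: fil_pred_sum => g _; apply: drinfeld_lower (y0h g) _.
by apply/(qpi_eq0 (@qsym_proper k n q)); move: (s0 g); rewrite !ffunE.
Qed.

(** An element of the kernel can be pushed down the filtration until it reaches
F_(-1) H = 0. *)
Lemma comparison_inj : injective h.
Proof.
apply: lrmorphism_inj => x; have [m] := fil_exhaustive FH x.
elim: m => [|m IH] Fx hx; last apply: IH (hx).
all: by apply: (comparison_strict Fx); rewrite hx; apply: fil_pred0.
Qed.

Lemma comparison_fil m x : FH m x -> F m (h x).
Proof. by move=> [y my ->]; rewrite h_pi; apply: phi_fil. Qed.

Lemma comparison_surj m u : F m u -> exists2 x, FH m x & h x = u.
Proof.
by move=> /phi_surj[y my ->]; exists (drinfeld_pi hp y); [exists y | exact: h_pi].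
Qed.

Lemma drinfeld_orbifold : quantum_drinfeld_orbifold hp actS.
Proof.
have [hgr [hgr_bij hgr_comp]] := gr_iso comparison_fil comparison_surj comparison_inj.
exists (Phi \o hgr); split; first exact: bij_comp hU.1 hgr_bij.
by move=> m x; rewrite hgr_comp hU.2.
Qed.

Lemma drinfeld_iso : exists g : {lrmorphism U -> drinfeld hp}, bijective g.
Proof.
have h_bij : bijective h.
  apply: inj_surj_bij comparison_inj _ => u.
  by have [m /comparison_surj[x _ <-]] := fil_exhaustive F u; exists x.
by have [g [hg gh]] := lrmorphism_inv h_bij; exists g; exists h.
Qed.

End Isomorphism.
End Deformation.
End Comparison.

Theorem theorem2p4 (k : fieldType) (hk : [pchar k] =i pred0)
    (n : nat) (V : vectType k) (b : n.-tuple V) (hb : basis_of fullv b)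
    (q : 'I_n -> 'I_n -> k)
    (q_neq0 : forall i j, q i j != 0)
    (q_diag : forall i, q i i = 1)
    (q_inv : forall i j, q j i = (q i j)^-1)
    (gT : finGroupType) (act : lin_action gT V)
    (actS : alg_action gT (qsym q)) (hact : induced_action b act actS)
    (U : algType k) (F : filtration U)
    (Phi : {lrmorphism assoc_gr F -> skew_group_alg actS})
    (hU : pbw_deformation Phi)
    (hpres : action_preserved b act Phi) :
  exists kappa : V -> V -> kVG V gT,
    [/\ (forall x, linear (kappa x)) /\ (forall y, linear (kappa ^~ y)),
        forall i j, kappa (tnth b i) (tnth b j) =
                    - q i j *: kappa (tnth b j) (tnth b i)
      & exists2 hp : is_proper (drinfeld_ideal hb act q kappa),
          quantum_drinfeld_orbifold hp actS
        & exists f : {lrmorphism U -> drinfeld hp}, bijective f].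
Proof.
case: hpres => theta theta_id theta_act.
have [f [phi [f_gen phiE phi_incl]]] := deformation_map hb hU theta_id theta_act.
have [kappa [kappaL kappa_anti phi_rel]] :=
  kappa_exists q_neq0 q_inv hU theta_id f_gen phiE phi_incl.
exists kappa; split=> //; have hp := drinfeld_proper phi_rel; exists hp.
all: have [h h_pi] := quot_lift hp (ideal_gen_ker phi_rel).
- exact: (drinfeld_orbifold hU theta_id f_gen phiE h_pi).
- exact: (drinfeld_iso hU theta_id f_gen phiE h_pi).
Qed.
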